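(* There exists a strongly prime skew left brace of abelian type that is not a simple skew left brace.
   Context: A skew left brace is a triple $(B,+,\circ)$ such that $(B,+)$ and $(B,\circ)$ are groups and $a\circ(b+c)=a\circ b-a+a\circ c$ for all $a,b,c\in B$; it is of abelian type if $(B,+)$ is abelian. The two groups share the same identity, denoted $0$. For $a\in B$ put $\lambda_a(b):=-a+a\circ b$. An ideal of $B$ is a subset $I\subseteq B$ that is a normal subgroup of $(B,+)$, a normal subgroup of $(B,\circ)$, and satisfies $\lambda_a(I)\subseteq I$ for all $a\in B$. $B$ is simple if its only ideals are $\{0\}$ and $B$. Put $a*b:=-a+a\circ b-b$; for $X,Y\subseteq B$, $X*Y$ denotes the additive subgroup generated by all $x*y$ with $x\in X$, $y\in Y$. The operation $*$ on subsets is not associative in general; a $*$-product of ideals means any finite product formed from them using $*$, with any bracketing. $B$ is strongly prime if every $*$-product of any number of non-zero ideals of $B$ is non-zero (i.e. $\neq\{0\}$). *)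

(* Defs.v *)
From mathcomp Require Import all_boot classical_sets.

Set Implicit Arguments.
Unset Strict Implicit.
Unset Printing Implicit Defensive.

Local Open Scope classical_set_scope.

(* A group structure is a value here, not a canonical structure keyed on the
   type as in monoid.v, because a skew left brace has two of them on the same
   carrier.  The carrier is arbitrary, possibly infinite. *)
Record group_on (T : Type) := GroupOn {
  gop : T -> T -> T;
  gunit : T;
  ginv : T -> T;
  gopA : forall x y z, gop x (gop y z) = gop (gop x y) z;
  gop1g : forall x, gop gunit x = x;
  gopg1 : forall x, gop x gunit = x;
  gopVg : forall x, gop (ginv x) x = gunit;
  gopgV : forall x, gop x (ginv x) = gunit
}.

Definition subgroup (T : Type) (G : group_on T) (H : set T) : Prop :=
  [/\ H (gunit G),
      forall x y, H x -> H y -> H (gop G x y) &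
      forall x, H x -> H (ginv G x)].

Definition normal_subgroup (T : Type) (G : group_on T) (H : set T) : Prop :=
  subgroup G H /\ forall g x, H x -> H (gop G (gop G g x) (ginv G g)).

Definition generated (T : Type) (G : group_on T) (X : set T) : set T :=
  smallest (subgroup G) X.

Declare Scope brace_scope.
Delimit Scope brace_scope with brace.

Record skew_left_brace := SkewLeftBrace {
  carrier :> Type;
  additive : group_on carrier;
  multiplicative : group_on carrier;
  brace_compat : forall a b c : carrier,
    gop multiplicative a (gop additive b c) =
    gop additive
      (gop additive (gop multiplicative a b) (ginv additive a))
      (gop multiplicative a c)
}.

Definition badd (B : skew_left_brace) : B -> B -> B := gop (additive B).
Definition bopp (B : skew_left_brace) : B -> B := ginv (additive B).
Definition bzero (B : skew_left_brace) : B := gunit (additive B).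
Definition bcirc (B : skew_left_brace) : B -> B -> B := gop (multiplicative B).

Notation "0" := (bzero _) : brace_scope.
Notation "x + y" := (badd x y) : brace_scope.
Notation "- x" := (bopp x) : brace_scope.
Notation "x - y" := (badd x (bopp y)) : brace_scope.
Notation "x \circ y" := (bcirc x y)
  (at level 40, left associativity) : brace_scope.

Local Open Scope brace_scope.

Lemma circ_addE (B : skew_left_brace) (a b c : B) :
  a \circ (b + c) = a \circ b - a + a \circ c.
Proof. exact: brace_compat. Qed.

Lemma circ_unit_eq0 (B : skew_left_brace) : gunit (multiplicative B) = 0.
Proof.
have H (a : B) : a \circ 0 = a.
  have := circ_addE a 0 0; rewrite {1}/badd gop1g => /(congr1 (badd (- (a \circ 0)))).
  rewrite /badd /bopp !gopA gopVg !gop1g => E.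
  have := congr1 (gop (additive B) a) E.
  by rewrite gopA gopgV gop1g gopg1 => <-.
by rewrite -[LHS]H /bcirc gop1g.
Qed.

Definition abelian_type (B : skew_left_brace) : Prop :=
  forall a b : B, a + b = b + a.

Definition lambda (B : skew_left_brace) (a b : B) : B := - a + a \circ b.

Definition ideal (B : skew_left_brace) (I : set B) : Prop :=
  [/\ normal_subgroup (additive B) I,
      normal_subgroup (multiplicative B) I &
      forall a : B, lambda a @` I `<=` I].

Definition simple_brace (B : skew_left_brace) : Prop :=
  forall I : set B, ideal I -> I = [set 0] \/ I = [set: B].

Definition star (B : skew_left_brace) (a b : B) : B := - a + a \circ b - b.

Definition set_star (B : skew_left_brace) (X Y : set B) : set B :=
  generated (additive B) [set star x y | x in X & y in Y].

(* X is a finite *-product of non-zero ideals, for some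
   number of factors and some bracketing. *)
Inductive star_product (B : skew_left_brace) : set B -> Prop :=
| star_product_ideal (I : set B) :
    ideal I -> I <> [set 0] -> star_product I
| star_product_star (X Y : set B) :
    star_product X -> star_product Y -> star_product (set_star X Y).

Definition strongly_prime (B : skew_left_brace) : Prop :=
  forall X : set B, star_product X -> X <> [set 0].

(* Main.v *)
Require Import Defs.
From mathcomp Require Import all_boot.
From mathcomp Require Import all_algebra boolp classical_sets ring lra zify.

(** A radical ring becomes a brace under [x \circ y = x + y + x * y]; its [*]
    operation is then the ring product and brace ideals are ring ideals.  If the
    ring is a domain, products of non-zero elements of the ideals show that all
    [*]-products of non-zero ideals are non-zero.  Here the radical ring is the
    maximal ideal [2 Z_(2)] of the localization of [Z] at [2], which has the
    proper non-zero ideal [4 Z_(2)]. *)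

Set Implicit Arguments.
Unset Strict Implicit.
Unset Printing Implicit Defensive.

Import GRing.Theory Num.Theory.
Local Open Scope ring_scope.

(** Membership in [2 Z_(2)]: [numq] is the numerator in lowest terms, so an even one forces an odd
    denominator. *)
Definition evenq (x : rat) : bool := (2 %| numq x)%Z.

Lemma odd_ratr_neq0 (b : int) : 1 + 2 * b%:~R != 0 :> rat.
Proof.
have -> : 1 + 2 * b%:~R = (1 + 2 * b)%:~R :> rat by rewrite rmorphD rmorphM.
by rewrite intr_eq0; lia.
Qed.

(** The fraction on the right need not be reduced, so closure properties follow from explicit
    witnesses and a field identity. *)
Lemma evenqP (x : rat) :
  reflect (exists a b : int, x = 2 * a%:~R / (1 + 2 * b%:~R)) (evenq x).
Proof.
apply: (iffP idP) => [/dvdzP[a numE]|[a [b xE]]].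
  have /dvdzP[b denE] : (2 %| denq x - 1)%Z.
    have := coprime_num_den x; rewrite numE abszM coprimeMl => /andP[_].
    by rewrite coprime2n; have := denq_gt0 x; lia.
  exists a, b; rewrite -[LHS]divq_num_den numE.
  have -> : denq x = 1 + 2 * b by lia.
  by rewrite !(rmorphD, rmorphM) [a%:~R * _]mulrC.
have E : numq x * (1 + 2 * b) = 2 * a * denq x.
  apply/eqP; rewrite -(eqr_int rat) !(rmorphM, rmorphD) /= numqE {1}xE.
  by apply/eqP; field; exact: odd_ratr_neq0.
by apply/dvdzP; exists (a * denq x - numq x * b); lia.
Qed.

Lemma evenqD (x y : rat) : evenq x -> evenq y -> evenq (x + y).
Proof.
move=> /evenqP[a [b ->]] /evenqP[c [d ->]]; apply/evenqP.
exists (a * (1 + 2 * d) + c * (1 + 2 * b)), (b + d + 2 * b * d).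
have := odd_ratr_neq0 (b + d + 2 * b * d).
rewrite !(rmorphD, rmorphM) /= => bd1.
by field; rewrite bd1 !odd_ratr_neq0.
Qed.

Lemma evenqN (x : rat) : evenq x -> evenq (- x).
Proof. by rewrite /evenq numqN rpredN. Qed.

Lemma evenqM (x y : rat) : evenq x -> evenq y -> evenq (x * y).
Proof.
move=> /evenqP[a [b ->]] /evenqP[c [d ->]]; apply/evenqP.
exists (2 * a * c), (b + d + 2 * b * d).
have := odd_ratr_neq0 (b + d + 2 * b * d).
rewrite !(rmorphD, rmorphM) /= => bd1.
by field; rewrite bd1 !odd_ratr_neq0.
Qed.

Lemma add1_evenq_neq0 (x : rat) : evenq x -> 1 + x != 0.
Proof.
(* The only bad value is [-1], whose numerator is odd. *)
by apply: contraTneq => x1; rewrite (_ : x = -1) //; lra.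
Qed.

(** Since [1 + (x + y + x * y) = (1 + x) * (1 + y)], this is the inverse of [x] for the circle
    operation. For [x = 2a / (1 + 2b)] it equals [-2a / (1 + 2(a + b))]. *)
Lemma evenq_quasi_inv (x : rat) : evenq x -> evenq (- x / (1 + x)).
Proof.
move=> xe; have := add1_evenq_neq0 xe.
have /evenqP[a [b xE]] := xe => x1; apply/evenqP; exists (- a), (a + b).
have b1 := odd_ratr_neq0 b; have ab1 := odd_ratr_neq0 (a + b).
move: x1 ab1; rewrite xE !(rmorphD, rmorphN) /= => x1 ab1.
by field; rewrite b1 ab1.
Qed.

Lemma evenq_circ (x y : rat) : evenq x -> evenq y -> evenq (x + y + x * y).
Proof. by move=> xe ye; rewrite !(evenqD, evenqM). Qed.

Definition evenrat : Type := {x : rat | evenq x}.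

Definition er0 : evenrat := Sub 0 isT.
Definition er_add (x y : evenrat) : evenrat :=
  Sub (val x + val y) (evenqD (valP x) (valP y)).
Definition er_opp (x : evenrat) : evenrat := Sub (- val x) (evenqN (valP x)).
Definition er_circ (x y : evenrat) : evenrat :=
  Sub (val x + val y + val x * val y) (evenq_circ (valP x) (valP y)).
Definition er_quasi_inv (x : evenrat) : evenrat :=
  Sub (- val x / (1 + val x)) (evenq_quasi_inv (valP x)).

Definition evenrat_additive : group_on evenrat.
Proof.
by apply: (@GroupOn _ er_add er0 er_opp) => *; apply: val_inj => /=; ring.
Defined.

Definition evenrat_multiplicative : group_on evenrat.
Proof.
apply: (@GroupOn _ er_circ er0 er_quasi_inv) => *; apply: val_inj => /=;
  by [ring | field; exact: add1_evenq_neq0 (valP _)].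
Defined.

Definition evenrat_brace : skew_left_brace.
Proof.
apply: (@SkewLeftBrace _ evenrat_additive evenrat_multiplicative) => a b c.
by apply: val_inj => /=; ring.
Defined.

Lemma val_star_evenrat (x y : evenrat_brace) : val (star x y) = val x * val y.
Proof. by rewrite /=; ring. Qed.

(** Exhibiting a non-zero element makes the induction work: the product of two such elements is a
    generator of the next [*]-product, and it is non-zero in a domain. *)
Lemma star_product_evenrat_neq0 (X : set evenrat_brace) :
  star_product X -> exists2 x, X x & val x != 0.
Proof.
elim=> [I [[[I0 _ _] _] _ _] In0|{}X Y _ [x Xx x0] _ [y Yy y0]].
  apply: contrapT => noX; apply: In0; apply/seteqP; split=> [x Ix|x ->] //.
  by apply: val_inj; apply: contrapT => /eqP x0; apply: noX; exists x.
exists (star x y); last by rewrite val_star_evenrat mulf_neq0.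
by apply: sub_gen_smallest; exists x => //; exists y.
Qed.

(** This is [4 Z_(2)]. *)
Definition quadrat : set evenrat_brace := [set x | evenq (val x / 2)].

Lemma ideal_quadrat : ideal quadrat.
Proof.
have halfD (u v : rat) : evenq (u / 2) -> evenq (v / 2) -> evenq ((u + v) / 2).
  by rewrite mulrDl; exact: evenqD.
have halfM (u v : rat) : evenq u -> evenq (v / 2) -> evenq (u * v / 2).
  by rewrite -mulrA; exact: evenqM.
have halfN (u : rat) : evenq (u / 2) -> evenq (- u / 2).
  by rewrite mulNr; exact: evenqN.
split.
- split; first by split=> //= [x y|x]; [exact: halfD | exact: halfN].
  by move=> g x; rewrite /quadrat /= addrAC subrr add0r.
- split; first split=> //= [[x xe] [y ye]|[x xe]]; rewrite /quadrat /=.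
  + by move=> Ix Iy; rewrite !(halfD, halfM).
  (* The circle inverse is split into [-x] and an even multiple of [-x], both in [quadrat]. *)
  + move=> /halfN INx; rewrite (_ : - x / (1 + x) = - x + (- x / (1 + x)) * - x).
      by rewrite halfD // halfM // evenq_quasi_inv.
    by field; exact: add1_evenq_neq0.
  + move=> [g ge] [x xe]; rewrite /quadrat /=.
    (* The circle operation is commutative, so conjugation is trivial. *)
    rewrite (_ : g + x + g * x + _ + _ = x) //.
    by field; exact: add1_evenq_neq0.
- move=> [a ae] _ [[x xe] Ix <-]; rewrite /quadrat /=.
  by rewrite (_ : _ + _ = x + a * x) ?halfD ?halfM //; ring.
Qed.

Theorem proposition22 :
  exists B : skew_left_brace,
    [/\ strongly_prime B, abelian_type B & ~ simple_brace B].
Proof.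
exists evenrat_brace; split=> [X /star_product_evenrat_neq0[x Xx x0] XE|x y|].
- by move: Xx x0; rewrite XE => ->.
- by apply: val_inj => /=; rewrite addrC.
- move=> /(_ _ ideal_quadrat)[] E.
  (* The element [4] shows that the ideal is non-zero; [2] lies outside it because [2 / 2 = 1] has
     odd numerator. *)
  + have : quadrat (Sub 4 isT) by [].
    by rewrite E => /(congr1 val).
  + have : quadrat (Sub 2 isT) by rewrite E.
    by [].
Qed.
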